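(* For every $\epsilon>0$, if $n$ is a sufficiently large primorial number, then the number of irreducible sums of cycles $X$ satisfying $C_n X=nC_n$ is at least $$n^{2^{\frac{\ln n}{(1+\epsilon)\ln \ln n}}}.$$
   Context: A sum of cycles is a finite digraph that is a disjoint union of directed cycles, considered up to isomorphism. $C_\ell$ is the directed cycle of length $\ell$ and $nC_\ell$ is the disjoint union of $n$ copies of $C_\ell$. The sum $A+B$ is disjoint union, and the product $AB$ is the direct product of digraphs, i.e. the distributive product with $C_aC_b=\gcd(a,b)\,C_{\operatorname{lcm}(a,b)}$. A sum of cycles $X$ is irreducible if, for all sums of cycles $A,B$, $X=AB$ implies $A=C_1$ or $B=C_1$. The $k$th primorial number is the product of the first $k$ primes; a primorial number is a $k$th primorial number for some $k\ge1$. *)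

(* Defs.v *)
From HB Require Import structures.
From mathcomp Require Import all_boot all_order all_algebra.
From mathcomp Require Import all_classical all_reals all_analysis.

Set Implicit Arguments.
Unset Strict Implicit.
Unset Printing Implicit Defensive.

Local Open Scope nat_scope.

(* Loops are allowed: the directed cycle of length 1 is a vertex with a loop,
   and the directed cycle of length 2 is a pair of opposite arcs. *)
Record digraph := Digraph { vertex :> finType; arc : rel vertex }.

Definition digraph_iso (G H : digraph) : Prop :=
  exists2 f : G -> H,
    bijective f & forall x y : G, arc (f x) (f y) = arc x y.

(* [ordS i] is [i + 1] modulo [l]; [dcycle 0] is the empty digraph. *)
Definition dcycle (l : nat) : digraph :=
  @Digraph 'I_l [rel i j | j == ordS i].

Definition dempty : digraph := @Digraph void [rel _ _ | false].

Definition dsum (G H : digraph) : digraph :=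
  @Digraph (G + H)%type
    (fun u v => match u, v with
                | inl x, inl y => arc x y
                | inr x, inr y => arc x y
                | _, _ => false
                end).

Definition dprod (G H : digraph) : digraph :=
  @Digraph (G * H)%type [rel u v | arc u.1 v.1 && arc u.2 v.2].

Definition dcopies (n : nat) (G : digraph) : digraph :=
  iter n (dsum G) dempty.

(* Digraphs are never quotiented: equality of sums of cycles is
   [digraph_iso]. The empty digraph counts as a sum of cycles. *)
Definition sum_of_cycles (G : digraph) : Prop :=
  exists2 ls : seq nat,
    all (leq 1) ls & digraph_iso G (foldr dsum dempty (map dcycle ls)).

Definition irreducible_soc (X : digraph) : Prop :=
  sum_of_cycles X /\
  forall A B : digraph, sum_of_cycles A -> sum_of_cycles B ->
    digraph_iso X (dprod A B) ->
    digraph_iso A (dcycle 1) \/ digraph_iso B (dcycle 1).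

(* [P] holds of exactly [N] digraphs up to isomorphism (for [P] invariant under
   isomorphism): [F] is a transversal of the isomorphism classes in [P]. *)
Definition count_up_to_iso (P : digraph -> Prop) (N : nat) : Prop :=
  exists F : 'I_N -> digraph,
    [/\ forall i, P (F i),
        forall i j, digraph_iso (F i) (F j) -> i = j
      & forall X, P X -> exists i, digraph_iso X (F i)].

Lemma prime_above_ex (m : nat) : exists p, (m < p) && prime p.
Proof. by have [p mp pp] := prime_above m; exists p; rewrite mp. Qed.

Definition next_prime (m : nat) : nat := ex_minn (prime_above_ex m).

(* Indexed from 0: [nth_prime 0 = 2], [nth_prime 1 = 3], etc *)
Definition nth_prime (i : nat) : nat := iter i next_prime 2.

Definition primorial (k : nat) : nat := \prod_(i < k) nth_prime i.

Definition is_primorial (n : nat) : Prop :=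
  exists2 k : nat, 1 <= k & n = primorial k.

(* Main.v *)
Require Import Defs.
From HB Require Import structures.
From mathcomp Require Import all_boot all_order all_algebra.
From mathcomp Require Import all_classical all_reals all_analysis.
From mathcomp Require Import zify lra.
(* [path] also exports a constant [arc]; the digraph projection must win. *)
Import Defs.

(** A sum of cycles [X] solves [C_n X = n C_n] as soon as it has [n] vertices
    and all its cycle lengths divide [n], because [C_n C_l = l C_n] when [l]
    divides [n] ([dprod_dcycle_soc]).  So the solutions correspond to the
    partitions of [n] into divisors of [n], and it is enough to find a large
    family of such partitions that give irreducible digraphs.

    Let [n = 2 N] be a primorial, with [N = 2 M + 1] odd.  The family consists of
    the sums [C_1 + C_N + (cycles of even length)] with [n] vertices.  To see
    that such an [X] is irreducible, count closed walks: the number [nclosed G d]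
    of vertices of [G] on a closed walk of length [d] is invariant under
    isomorphism, additive for sums, multiplicative for products, and equals [l]
    or [0] on [C_l], according to whether [l] divides [d].  Since divisors of [N]
    are odd, [nclosed X d] is [1] for proper divisors [d] of [N] and [N + 1] for
    [d = N].  If [X = A B], then [A] and [B] also have value [1] at all proper
    divisors of [N], while one of them has a value greater than [1] at [N]; that
    factor contains both [C_1] and [C_N], hence more than half of the [n]
    vertices, and the other one has a single vertex
    ([irreducible_soc_criterion]).

    The even part of [X] is [x_e] copies of [C_(2 e)] for each divisor [e > 1] of
    [N] with [e ^ 2 <= N], completed by copies of [C_2].  The [x_e] may be chosen
    independently in [0 .. B], where [B] is about [M] divided by the sum of the
    [e], and closed walk counts recover them from [X].  When [n] is the product
    of [k] primes, [N] has [2 ^ (k - 1)] divisors, half of which are small, so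
    that there are about [2 ^ (k - 2)] exponents [e] while [B] is at least about
    [sqrt n / 2 ^ k >= n ^ (1 / 8)]: this yields at least [n ^ (2 ^ (k - 6))]
    irreducible solutions ([count_irreducible_primorial]).

    It remains to compare [k - 6] with [ln n / ((1 + eps) ln (ln n))]
    ([ln_primorial_le]).  Write [q] for the largest prime factor of [n]; then
    [ln n <= k ln q], and [ln (ln n) >= ln k - ln 2] because [n >= 2 ^ k].  So only
    [ln q <= (1 + o(1)) ln k] is needed, which is much weaker than the prime
    number theorem: it follows from the bound
    [2 ^ m <= 'C(2 m, m) <= (2 m) ^ pi (2 m)], where [pi] is the prime counting
    function ([exp2_le_exp_nth_prime]). *)

Set Implicit Arguments.
Unset Strict Implicit.
Unset Printing Implicit Defensive.

Local Open Scope nat_scope.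

(** * Isomorphism of digraphs *)

Lemma digraph_iso_refl (G : digraph) : digraph_iso G G.
Proof. by exists id => //; exists id. Qed.

Lemma digraph_iso_sym (G H : digraph) : digraph_iso G H -> digraph_iso H G.
Proof.
move=> [f [g fK gK] farc]; exists g; first by exists f.
by move=> x y; rewrite -farc !gK.
Qed.

Lemma digraph_iso_trans (G H K : digraph) :
  digraph_iso G H -> digraph_iso H K -> digraph_iso G K.
Proof.
move=> [f fbij farc] [g gbij garc]; exists (g \o f); first exact: bij_comp.
by move=> x y /=; rewrite garc farc.
Qed.

Lemma digraph_iso_card (G H : digraph) : digraph_iso G H -> #|G| = #|H|.
Proof. by move=> [f fbij _]; exact: bij_eq_card fbij. Qed.

Lemma inj_digraph_iso (G H : digraph) (f : G -> H) :
    injective f -> #|H| <= #|G| ->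
  (forall x y, arc (f x) (f y) = arc x y) -> digraph_iso G H.
Proof. by move=> finj leHG farc; exists f => //; exact: inj_card_bij. Qed.

(** * Closed walks *)

Fixpoint walk (G : digraph) (d : nat) (x y : G) : bool :=
  if d is d'.+1 then [exists z, arc x z && walk d' z y] else x == y.

Definition nclosed (G : digraph) (d : nat) : nat := #|[pred x : G | walk d x x]|.

Lemma walk_iso (G H : digraph) (f : G -> H) d x y :
    bijective f -> (forall x y, arc (f x) (f y) = arc x y) ->
  walk d (f x) (f y) = walk d x y.
Proof.
move=> fbij farc; have [g fK gK] := fbij.
elim: d x => [|d IHd] x /=; first by rewrite (inj_eq (bij_inj fbij)).
apply/existsP/existsP => [] [z]; last by exists (f z); rewrite farc IHd.
by exists (g z); rewrite -farc -IHd gK.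
Qed.

Lemma nclosed_iso (G H : digraph) d :
  digraph_iso G H -> nclosed G d = nclosed H d.
Proof.
move=> [f fbij farc]; rewrite /nclosed.
rewrite -(on_card_preimset (onW_bij _ fbij)).
by apply: eq_card => x; rewrite !inE (walk_iso _ _ _ fbij farc).
Qed.

Lemma nclosed0 (G : digraph) : nclosed G 0 = #|G|.
Proof. by apply: eq_card => x; rewrite !inE /= eqxx. Qed.

Lemma walk_dprod (G H : digraph) d (u v : dprod G H) :
  walk d u v = walk d u.1 v.1 && walk d u.2 v.2.
Proof.
elim: d u => [|d IHd] [x x'] //=.
apply/existsP/andP => [[[z z']]|[/existsP[z /andP[xz zv]] /existsP[z' /andP[xz' zv']]]].
  rewrite IHd /= => /andP[/andP[xz xz'] /andP[zv zv']].
  by split; apply/existsP; [exists z | exists z']; apply/andP.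
by exists (z, z'); rewrite IHd /= xz xz' zv zv'.
Qed.

Lemma nclosed_dprod (G H : digraph) d :
  nclosed (dprod G H) d = nclosed G d * nclosed H d.
Proof.
rewrite /nclosed -cardX; apply: eq_card => -[x y].
by rewrite !inE /= walk_dprod.
Qed.

Lemma walk_dsum (G H : digraph) d (u v : dsum G H) :
  walk d u v = match u, v with
               | inl x, inl y => walk d x y
               | inr x, inr y => walk d x y
               | _, _ => false
               end.
Proof.
elim: d u v => [|d IHd] u v /=; first by case: u; case: v.
case: u v => [x|x] [y|y].
- apply/existsP/existsP => [[] [] z|[z]]; rewrite ?IHd //=; first by exists z.
  by move=> xz; exists (inl z); rewrite IHd.
- by apply/existsP => -[] [] z; rewrite IHd //= andbF.
- by apply/existsP => -[] [] z; rewrite IHd //= andbF.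
- apply/existsP/existsP => [[] [] z|[z]]; rewrite ?IHd //=; first by exists z.
  by move=> xz; exists (inr z); rewrite IHd.
Qed.

Lemma nclosed_dsum (G H : digraph) d :
  nclosed (dsum G H) d = nclosed G d + nclosed H d.
Proof.
rewrite /nclosed -!sum1_card big_sumType /=.
by congr (_ + _); apply: eq_bigl => x; rewrite !inE walk_dsum.
Qed.

Lemma walk_dcycle l d (i j : dcycle l) : walk d i j = (i + d == j %[mod l]).
Proof.
case: l i j => [[]//|l] i j.
elim: d i => [|d IHd] i /=; first by rewrite addn0 !modn_small.
rewrite -addSnnS -(modnDml i.+1); apply/existsP/idP => [[z]|ij].
  by rewrite IHd => /andP[/eqP ->].
by exists (ordS i); rewrite eqxx IHd.
Qed.

Lemma nclosed_dcycle l d : nclosed (dcycle l) d = l * (l %| d).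
Proof.
rewrite /nclosed (eq_card (B := [pred x : 'I_l | l %| d])); last first.
  move=> i; rewrite !inE walk_dcycle.
  by have := eqn_modDl i d 0 l; rewrite addn0 mod0n.
case: (l %| d); first by rewrite muln1 -[RHS]card_ord.
by rewrite muln0 card0.
Qed.

(** The representatives used by [sum_of_cycles], so that digraphs can be studied
    through their lists of cycle lengths. *)
Definition soc (ls : seq nat) : digraph := foldr dsum dempty (map dcycle ls).

Lemma nclosed_soc ls d : nclosed (soc ls) d = \sum_(l <- ls | l %| d) l.
Proof.
elim: ls => [|l ls IHls]; last first.
  rewrite /soc/= nclosed_dsum IHls nclosed_dcycle big_cons.
  by case: (l %| d); rewrite ?muln1 ?muln0.
by rewrite big_nil /nclosed eq_card0 // => -[].
Qed.

Lemma card_soc ls : #|soc ls| = sumn ls.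
Proof. by rewrite -nclosed0 nclosed_soc sumnE; apply: eq_bigl => l; rewrite dvdn0. Qed.

(** The sums of [l] over the cycle lengths [l] dividing [d], which are the closed
    walk counts, determine the multiplicities: among the divisors of [l], all but
    [l] itself are already known by induction. *)
Lemma count_mem_soc_iso ls ls' l : digraph_iso (soc ls) (soc ls') -> 0 < l ->
  count_mem l ls = count_mem l ls'.
Proof.
move=> iso_ls; have fE d := nclosed_iso d iso_ls.
elim/ltn_ind: l => l IHl l_gt0.
have sumE s : \sum_(k <- s | k %| l) k = \sum_(d <- divisors l) count_mem d s * d.
  under [RHS]eq_bigr do rewrite -sum1_count big_distrl /=.
  rewrite (exchange_big_dep xpredT) //= big_mkcond; apply: eq_bigr => k _.
  rewrite dvdn_divisors //; under eq_bigr do rewrite mul1n.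
  have [kl|kl] := ifP; last first.
    rewrite big_seq_cond big1 // => d /andP[dl /eqP kd].
    by rewrite /= kd dl in kl.
  rewrite (big_rem k) //= eqxx big_seq_cond big1 ?addn0 // => d /andP[dl /eqP kd].
  by move: dl; rewrite -kd rem_filter ?divisors_uniq // mem_filter /= eqxx.
have := fE l; rewrite !nclosed_soc !sumE.
have ldiv : l \in divisors l by rewrite -dvdn_divisors.
rewrite !(big_rem l ldiv) /= [X in _ = _ + X -> _](eq_big_seq (fun d => count_mem d ls * d)).
  by move=> /addIn/eqP; rewrite eqn_pmul2r // => /eqP.
move=> d; rewrite rem_filter ?divisors_uniq // mem_filter -dvdn_divisors //=.
move=> /andP[dl /[dup] d_l /dvdn_leq dle]; congr (_ * _); apply/esym/IHl.
  by rewrite ltn_neqAle dl dle.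
by apply: dvdn_gt0 d_l.
Qed.

(** * Irreducibility *)

Lemma add_le_cycle_sum ls (P : pred nat) l m : l != m -> l \in ls -> m \in ls ->
  P l -> P m -> l + m <= \sum_(k <- ls | P k) k.
Proof.
move=> lm lls mls Pl Pm; rewrite (big_rem l) //= Pl leq_add2l (big_rem m) /=.
  by rewrite Pm leq_addr.
move: mls; rewrite (perm_mem (perm_to_rem lls)) inE.
by rewrite eq_sym (negPf lm).
Qed.

(** A sum with one closed walk vertex at each proper divisor of [N] has exactly one
    loop and no other cycle of length properly dividing [N].  Any excess at [N]
    therefore comes from a cycle of length [N], which sits beside the loop. *)
Lemma large_factor ls N :
    (forall d, d %| N -> d != N -> \sum_(l <- ls | l %| d) l = 1) ->
  1 < N -> 1 < \sum_(l <- ls | l %| N) l -> N < sumn ls.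
Proof.
move=> ls_div N_gt1 lsN.
have ls1 : \sum_(l <- ls | l %| 1) l = 1 by apply: ls_div; lia.
have one_ls : 1 \in ls.
  apply: contraTT isT => one_ls; move: ls1; rewrite big_seq_cond big1 //.
  by move=> l /andP[lls]; rewrite dvdn1 => /eqP l1; rewrite -l1 lls in one_ls.
have /hasP[l lls /andP[lN l1]] : has [pred l | (l %| N) && (l != 1)] ls.
  apply: contraTT lsN => /hasPn no_l; rewrite -leqNgt -[leqRHS]ls1.
  rewrite big_seq_cond [leqRHS]big_seq_cond.
  rewrite (eq_bigl (fun i => (i \in ls) && (i %| 1))) // => i.
  have [ils|//] := boolP (i \in ls); have := no_l _ ils.
  rewrite /= dvdn1; have [->|_] := eqVneq i 1; first by rewrite dvd1n.
  by rewrite andbT => /negPf.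
have lN_eq : l = N.
  apply: contraTeq lN => l_neqN; apply/negP => lN.
  have := ls_div l lN l_neqN.
  have := @add_le_cycle_sum ls [pred k | k %| l] 1 l; rewrite eq_sym l1 => /(_ isT one_ls lls).
  by move=> /= /(_ (dvd1n _) (dvdnn _)) le1 e; move: le1; rewrite e; lia.
have := @add_le_cycle_sum ls predT 1 l; rewrite eq_sym l1 => /(_ isT one_ls lls isT isT).
by rewrite -sumnE lN_eq.
Qed.

Lemma soc_sum1 ls : all (leq 1) ls -> sumn ls = 1 -> digraph_iso (soc ls) (dcycle 1).
Proof.
case: ls => [|l ls] //= /andP[l_gt0 ls_gt0] ls1.
have -> : ls = [::] by case: ls ls_gt0 ls1 => [|m ls] //= /andP[]; lia.
have -> : l = 1 by lia.
rewrite /soc /=; apply: digraph_iso_sym.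
apply: (@inj_digraph_iso _ (dsum (dcycle 1) dempty) inl) => //.
  by move=> x y [].
by rewrite card_sum (eq_card0 (A := dempty)) ?addn0 // => -[].
Qed.

(** In a factorization both factors have value [1] at the proper divisors of [N].
    They cannot both have value [1] at [N], and [large_factor] shows that the one
    that does not has more than half of the vertices. *)
Lemma irreducible_soc_criterion N ls : 1 < N ->
    all (leq 1) ls -> sumn ls = N.*2 ->
    (forall d, d %| N -> \sum_(l <- ls | l %| d) l = if d == N then N.+1 else 1) ->
  irreducible_soc (soc ls).
Proof.
move=> N_gt1 ls_gt0 ls_sum ls_div; split; first by exists ls => //; exact: digraph_iso_refl.
move=> A B [la la_gt0 Ala] [lb lb_gt0 Blb] isoAB.
have fM d : \sum_(l <- ls | l %| d) l =
    (\sum_(l <- la | l %| d) l) * (\sum_(l <- lb | l %| d) l).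
  rewrite -(nclosed_soc ls d) -(nclosed_soc la d) -(nclosed_soc lb d).
  by rewrite (nclosed_iso d isoAB) nclosed_dprod (nclosed_iso d Ala) (nclosed_iso d Blb).
have sum0 s : \sum_(l <- s | l %| 0) l = sumn s.
  by rewrite sumnE; apply: eq_bigl => l; rewrite dvdn0.
have abN : sumn la * sumn lb = N.*2 by rewrite -ls_sum -!sum0.
have fN := fM N; rewrite ls_div // eqxx in fN.
have div1 d : d %| N -> d != N ->
    \sum_(l <- la | l %| d) l = 1 /\ \sum_(l <- lb | l %| d) l = 1.
  move=> dN dneq; have := fM d; rewrite ls_div // (negPf dneq) => /esym/eqP.
  by rewrite muln_eq1 => /andP[/eqP-> /eqP->].
have [a1|a1] := leqP (\sum_(l <- la | l %| N) l) 1; [left|right].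
  apply: digraph_iso_trans Ala _; apply: soc_sum1 => //.
  have : N < sumn lb; last nia.
  apply: large_factor => //; first by move=> d dN /(div1 d dN)[].
  by move: fN a1; case: (bigop _ _ _) => [|[|]] //; lia.
apply: digraph_iso_trans Blb _; apply: soc_sum1 => //.
have : N < sumn la; last nia.
by apply: large_factor => // d dN /(div1 d dN)[].
Qed.

(** * Multiplication by a long cycle *)

(** The product with this digraph of [m] isolated loops is the union of [m]
    copies; unlike [dcopies], it has a vertex type that is a product. *)
Definition loops (m : nat) : digraph := @Digraph 'I_m [rel i j | i == j].

Lemma dcopies_loops m (G : digraph) : digraph_iso (dcopies m G) (dprod (loops m) G).
Proof.
elim: m => [|m [f fbij farc]].
  apply: (@inj_digraph_iso dempty (dprod (loops 0) G) (fun v : void => match v with end)).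
  - by case.
  - by rewrite card_prod card_ord mul0n.
  - by case.
pose g (u : dsum G (dcopies m G)) : dprod (loops m.+1) G :=
  match u with inl x => (ord0, x) | inr y => (lift ord0 (f y).1, (f y).2) end.
apply: (@inj_digraph_iso (dsum G (dcopies m G)) _ g).
- move=> [x|x] [y|y] //=; first by case=> ->.
  move=> [] /ord_inj e1 e2; congr inr; apply: (bij_inj fbij).
  by apply: injective_projections => //; apply: (@lift_inj _ ord0); apply: val_inj.
- rewrite card_sum (bij_eq_card fbij) !card_prod !card_ord; lia.
- move=> [x|x] [y|y] //=.
  by rewrite (inj_eq lift_inj) -farc.
Qed.

Definition periodic (n : nat) (G : digraph) : Prop :=
  exists2 s : G -> G, forall x y : G, arc x y = (y == s x) & forall x, iter n s x = x.

Lemma periodic_dsum n G H : periodic n G -> periodic n H -> periodic n (dsum G H).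
Proof.
move=> [s sarc sn] [t tarc tn].
exists (fun u => match u with inl x => inl (s x) | inr y => inr (t y) end).
  by move=> [x|x] [y|y] //=.
move=> [x|x].
  by rewrite -{2}(sn x); elim: n {sn tn} => //= n ->.
by rewrite -{2}(tn x); elim: n {sn tn} => //= n ->.
Qed.

Lemma periodic_dcycle n l : l %| n -> periodic n (dcycle l).
Proof.
move=> /dvdnP[q ->]; exists (@ordS l) => // i; apply: val_inj.
have iter_ordS m : val (iter m (@ordS l) i) = (i + m) %% l.
  elim: m => [|m IHm] /=; first by rewrite addn0 modn_small.
  by rewrite IHm -addn1 modnDml addn1 addnS.
by rewrite iter_ordS addnC modnMDl modn_small.
Qed.

Lemma periodic_soc n ls : all (dvdn^~ n) ls -> periodic n (soc ls).
Proof.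
elim: ls => [_|l ls IHls /= /andP[ln lsn]].
  by exists id => [[]|[]].
by apply: periodic_dsum; [exact: periodic_dcycle | exact: IHls].
Qed.

(** Moving [x] along its cycle until the first coordinate is back at [0] gives a
    second coordinate that does not change along the arcs of the product: this
    straightens the product into one copy of [C_n] per vertex of [G]. *)
Lemma dprod_dcycle_periodic n G : 0 < n -> periodic n G ->
  digraph_iso (dprod (dcycle n) G) (dcopies #|G| (dcycle n)).
Proof.
case: n => // n _ [s sarc sn].
have s_inj : injective s.
  by move=> x y sxy; rewrite -[x]sn -[y]sn !iterSr sxy.
apply: digraph_iso_trans (digraph_iso_sym (dcopies_loops _ _)).
pose f (u : dprod (dcycle n.+1) G) : dprod (loops #|G|) (dcycle n.+1) :=
  (enum_rank (iter (n.+1 - u.1) s u.2), u.1).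
apply: (@inj_digraph_iso _ _ f).
- move=> [i x] [j y] [] /= /enum_rank_inj e ij; rewrite -{}ij in e *.
  congr (_, _); elim: (n.+1 - i) e => //= m IHm /s_inj; exact: IHm.
- by rewrite !card_prod !card_ord mulnC.
move=> [i x] [j y] /=; rewrite andbC; case: eqP => //= ->.
rewrite (inj_eq enum_rank_inj) sarc /=.
have [in_|in_] := ltnP i n.
  rewrite modn_small // subSS subSn 1?ltnW // iterSr eq_sym.
  by elim: (n - i) => //= m IHm; rewrite (inj_eq s_inj).
have -> : i = n :> nat by apply/eqP; rewrite eqn_leq in_ -ltnS ltn_ord.
by rewrite modnn subn0 subSnn sn eq_sym.
Qed.

Lemma dprod_dcycle_soc n ls : 0 < n -> all (dvdn^~ n) ls -> sumn ls = n ->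
  digraph_iso (dprod (dcycle n) (soc ls)) (dcopies n (dcycle n)).
Proof.
move=> n_gt0 lsn sum_ls; rewrite -{2}sum_ls -card_soc.
exact: dprod_dcycle_periodic (periodic_soc lsn).
Qed.

(** * Counting isomorphism classes *)

Definition ord_digraph n (r : {ffun 'I_n * 'I_n -> bool}) : digraph :=
  @Digraph 'I_n [rel i j | r (i, j)].

Lemma ord_digraphP n (G : digraph) : #|G| = n ->
  exists r : {ffun 'I_n * 'I_n -> bool}, digraph_iso G (ord_digraph r).
Proof.
move=> Gn; pose f (x : G) : 'I_n := cast_ord Gn (enum_rank x).
pose g (i : 'I_n) : G := enum_val (cast_ord (esym Gn) i).
have fK : cancel f g by move=> x; rewrite /g /f cast_ordK enum_rankK.
exists [ffun p => arc (g p.1) (g p.2)].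
apply: (@inj_digraph_iso G (ord_digraph _) f).
- exact: can_inj fK.
- by rewrite card_ord Gn.
- by move=> x y; rewrite /= ffunE /= !fK.
Qed.

(** Digraphs with [n] vertices can be moved to ['I_n], where there are finitely
    many.  Choosing one representative in each isomorphism class gives the
    transversal, and pairwise non-isomorphic solutions have distinct
    representatives. *)
Lemma count_up_to_iso_ge (P : digraph -> Prop) n (U : finType) (F : U -> digraph) :
    (forall X, P X -> #|X| = n) -> (forall u, P (F u)) ->
    (forall u v, digraph_iso (F u) (F v) -> u = v) ->
  exists2 N, count_up_to_iso P N & #|U| <= N.
Proof.
move=> P_card PF F_inj; pose T := {ffun 'I_n * 'I_n -> bool}.
pose R (r s : T) := `[< digraph_iso (ord_digraph r) (ord_digraph s) >].
have Rrefl r : R r r by apply/asboolP; exact: digraph_iso_refl.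
have Rtrans r s t : R r s -> R s t -> R r t.
  by move=> /asboolP rs /asboolP st; apply/asboolP; exact: digraph_iso_trans rs st.
have Rsym r s : R r s -> R s r.
  by move=> /asboolP rs; apply/asboolP; exact: digraph_iso_sym.
(* [pick] depends on the predicate only, so [c] is constant on each class. *)
pose c r := odflt r [pick s | R r s].
have Rc r : R r (c r).
  by rewrite /c; case: pickP => [s|/(_ r)]; rewrite ?Rrefl.
have c_eq r s : R r s -> c r = c s.
  move=> rs; rewrite /c.
  have /eq_pick-> : R r =1 R s.
    by move=> t; apply/idP/idP; [apply/Rtrans/Rsym | apply: Rtrans].
  by case: pickP => // /(_ s); rewrite Rrefl.
pose Q (r : T) := exists2 X, P X & digraph_iso X (ord_digraph r).
pose S : {set T} := [set r | `[< Q r >] && (c r == r)]%SET.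
have cS X : P X -> exists2 r, r \in S & digraph_iso X (ord_digraph r).
  move=> PX; have [r Xr] := ord_digraphP (P_card _ PX).
  have Xc : digraph_iso X (ord_digraph (c r)).
    by apply: digraph_iso_trans Xr _; apply/asboolP/Rc.
  exists (c r) => //; rewrite inE; apply/andP; split; first by apply/asboolP; exists X.
  by rewrite -(c_eq _ _ (Rc r)).
have repr (i : 'I_#|S|) : {X | P X & digraph_iso X (ord_digraph (enum_val i))}.
  move: (enum_valP i); rewrite inE => /andP[/asboolP Qi _].
  exact: cid2.
have S_inj r s : r \in S -> s \in S -> R r s -> r = s.
  move=> rS sS /c_eq; move: rS sS; rewrite !inE.
  by move=> /andP[_ /eqP->] /andP[_ /eqP->].
exists #|S|.
  exists (fun i => s2val (repr i)); split.
  - by move=> i; case: (repr i).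
  - move=> i j; case: (repr i) (repr j) => [X _ Xi] [Y _ Yj] /= XY.
    apply/enum_val_inj/S_inj; rewrite ?enum_valP //; apply/asboolP.
    exact: digraph_iso_trans (digraph_iso_trans (digraph_iso_sym Xi) XY) Yj.
  - move=> X /cS[r rS Xr]; exists (enum_rank_in rS r).
    case: (repr _) => Y _ /=; rewrite enum_rankK_in // => Yr.
    exact: digraph_iso_trans Xr (digraph_iso_sym Yr).
have Fr u : {r | r \in S & digraph_iso (F u) (ord_digraph r)} by exact/cid2/cS.
rewrite -cardsT -(card_in_imset (f := fun u => s2val (Fr u))).
  by apply/subset_leq_card/fintype.subsetP => r /imsetP[u _ ->]; case: (Fr u).
move=> u v _ _; case: (Fr u) (Fr v) => [r _ ur] [s _ vs] /= rs; apply: F_inj.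
by apply: digraph_iso_trans ur _; rewrite rs; exact: digraph_iso_sym.
Qed.

(** * A family of irreducible solutions *)

Section Family.

Variables (N M : nat) (I : finType) (e : I -> nat).

(** The cycles of length [2] bring the total length to [2 N] when [N = 2 M + 1]. *)
Definition family_cycles (x : I -> nat) : seq nat :=
  1 :: N :: nseq (M - \sum_i x i * e i) 2
    ++ flatten [seq nseq (x i) (e i).*2 | i <- enum I].

Lemma sumn_family_cycles x : N = M.*2.+1 -> \sum_i x i * e i <= M ->
  sumn (family_cycles x) = N.*2.
Proof.
move=> NM xM; have tailE : sumn (flatten [seq nseq (x i) (e i).*2 | i <- enum I]) =
    (\sum_i x i * e i).*2.
  rewrite sumn_flatten -map_comp sumnE big_map big_enum.
  rewrite (big_morph double doubleD double0); apply: eq_bigr => i _.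
  by apply: etrans (sumn_nseq _ _) _; rewrite -doubleMl mulnC.
by rewrite /= sumn_cat sumn_nseq tailE NM; lia.
Qed.

Lemma count_family_cycles x l :
  count_mem l (family_cycles x) =
    (1 == l) + (N == l) + (M - \sum_i x i * e i) * (2 == l)
      + \sum_i x i * ((e i).*2 == l).
Proof.
have tailE : count_mem l (flatten [seq nseq (x i) (e i).*2 | i <- enum I]) =
    \sum_i x i * ((e i).*2 == l).
  rewrite count_flatten -map_comp sumnE big_map big_enum; apply: eq_bigr => i _.
  by apply: etrans (count_nseq _ _ _) _; rewrite mulnC.
by rewrite /= count_cat count_nseq tailE mulnC !addnA.
Qed.

Hypotheses (N_gt1 : 1 < N) (NM : N = M.*2.+1).
Hypotheses (e_inj : injective e) (e_gt1 : forall i, 1 < e i).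
Hypothesis (e_dvd : forall i, e i %| N).

Let odd_N : odd N. Proof. by rewrite NM /= odd_double. Qed.

Lemma irreducible_family x : \sum_i x i * e i <= M ->
  irreducible_soc (soc (family_cycles x)).
Proof.
move=> xM; apply: (irreducible_soc_criterion N_gt1).
- rewrite /= ltnW //= all_cat all_nseq orbT /=.
  apply/allP => l /flatten_mapP[i _ /nseqP[-> _]].
  by rewrite double_gt0 ltnW.
- exact: sumn_family_cycles.
move=> d dN; rewrite big_cons dvd1n big_cons big_hasC; last first.
  have d_odd : odd d by apply: dvdn_odd dN odd_N.
  rewrite has_cat negb_or; apply/andP; split; apply/hasPn => l.
    by move=> /nseqP[-> _]; rewrite /= dvdn2 d_odd.
  move=> /flatten_mapP[i _ /nseqP[-> _]]; apply/negP => /dvdn_odd/(_ d_odd).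
  by rewrite odd_double.
have -> : (N %| d) = (d == N).
  by apply/idP/eqP => [Nd|->//]; apply/eqP; rewrite eqn_dvd dN.
by case: (d == N); rewrite !addn0 ?add1n.
Qed.

Lemma dprod_dcycle_family x : \sum_i x i * e i <= M ->
  digraph_iso (dprod (dcycle N.*2) (soc (family_cycles x)))
              (dcopies N.*2 (dcycle N.*2)).
Proof.
move=> xM; apply: dprod_dcycle_soc; first lia; last exact: sumn_family_cycles.
rewrite /= dvd1n -muln2 dvdn_mulr //= all_cat all_nseq dvdn_mull // orbT /=.
apply/allP => l /flatten_mapP[i _ /nseqP[-> _]].
by rewrite -muln2 dvdn_mul.
Qed.

Lemma family_inj x y :
    digraph_iso (soc (family_cycles x)) (soc (family_cycles y)) ->
  x =1 y.
Proof.
move=> xy i; have := count_mem_soc_iso (l := (e i).*2) xy.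
rewrite double_gt0 ltnW // => /(_ isT).
have e2 : (1 == (e i).*2) = false by have := e_gt1 i; lia.
have e3 : (2 == (e i).*2) = false by have := e_gt1 i; lia.
have e4 : (N == (e i).*2) = false.
  by apply: contraTF odd_N => /eqP->; rewrite odd_double.
have sumE z : \sum_j z j * ((e j).*2 == (e i).*2) = z i.
  rewrite (bigD1 i) //= eqxx muln1 big1 ?addn0 // => j ji.
  by rewrite (inj_eq double_inj) (inj_eq e_inj) (negPf ji) muln0.
by rewrite !count_family_cycles e2 e3 e4 !sumE !muln0.
Qed.

(** The bound on [B] makes every choice of multiplicities [x i <= B] fit into the
    available length. *)
Lemma count_irreducible_ge B : (\sum_i e i) * B <= M ->
  exists2 K, count_up_to_iso
    (fun X : digraph => irreducible_soc X /\
       digraph_iso (dprod (dcycle N.*2) X) (dcopies N.*2 (dcycle N.*2))) K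
  & B.+1 ^ #|I| <= K.
Proof.
move=> eB; have [] := @count_up_to_iso_ge (fun X : digraph => irreducible_soc X /\
       digraph_iso (dprod (dcycle N.*2) X) (dcopies N.*2 (dcycle N.*2))) N.*2
  _ (fun x : {ffun I -> 'I_B.+1} => soc (family_cycles (val \o x))).
- move=> X [_ /digraph_iso_card]; rewrite (digraph_iso_card (dcopies_loops _ _)).
  rewrite !card_prod !card_ord => /eqP; rewrite eqn_pmul2l; last lia.
  by move=> /eqP.
- move=> x; have xM : \sum_i (val \o x) i * e i <= M.
    apply: leq_trans eB; rewrite big_distrl /=; apply: leq_sum => i _.
    by rewrite mulnC leq_mul2l -ltnS ltn_ord orbT.
  by split; [exact: irreducible_family | exact: dprod_dcycle_family].
- move=> x y /family_inj xy; apply/ffunP => i; apply: val_inj; exact: xy.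
by move=> K PK leK; exists K => //; rewrite card_ffun card_ord in leK.
Qed.
End Family.

(** * The sequence of primes and the central binomial coefficient *)

Lemma next_primeP m : [/\ m < next_prime m, prime (next_prime m) &
  forall p, m < p -> prime p -> next_prime m <= p].
Proof.
rewrite /next_prime; case: ex_minnP => p /andP[mp p_pr] p_min; split=> // q mq q_pr.
by apply: p_min; rewrite mq.
Qed.

Lemma prime_nth_prime i : prime (nth_prime i).
Proof. by case: i => // i; have [] := next_primeP (nth_prime i). Qed.

Lemma ltn_nth_primeS i : nth_prime i < nth_prime i.+1.
Proof. by have [] := next_primeP (nth_prime i). Qed.

Lemma leq_nth_prime : {mono nth_prime : i j / i <= j}.
Proof. by apply: leq_mono; apply: (homo_ltn ltn_trans); exact: ltn_nth_primeS. Qed.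

Lemma nth_prime_inj : injective nth_prime.
Proof. by apply: incn_inj; exact: leq_nth_prime. Qed.

Lemma nth_prime_gt i : i < nth_prime i.
Proof. by elim: i => // i IHi; apply: leq_trans (ltn_nth_primeS i). Qed.

Lemma prime_lt_nth_prime j p : prime p -> p < nth_prime j ->
  exists2 i, i < j & p = nth_prime i.
Proof.
move=> p_pr; elim: j => [|j IHj] pj.
  by have := prime_gt1 p_pr; move: pj; rewrite /nth_prime /=; lia.
have [/IHj[i ij ->]|jp] := ltnP p (nth_prime j); first by exists i; rewrite 1?ltnW.
exists j => //; apply/eqP; rewrite eqn_leq jp andbT leqNgt; apply/negP => jltp.
have [_ _ /(_ p jltp p_pr)] := next_primeP (nth_prime j).
by move: pj => /=; rewrite ltnNge => /negP.
Qed.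

(** By Legendre's formula, the exponent of [p] is the sum over [i >= 1] of
    [m.*2 %/ p ^ i - 2 * (m %/ p ^ i)]; each term is at most [1], and it vanishes
    when [p ^ i > m.*2]. *)
Lemma pfactor_bin_le p m : prime p -> 0 < m -> p ^ logn p 'C(m.*2, m) <= m.*2.
Proof.
move=> p_pr m_gt0; have p_gt1 := prime_gt1 p_pr.
have mm_gt0 : 0 < m.*2 by rewrite double_gt0.
apply: leq_trans (trunc_logP p_gt1 mm_gt0); rewrite leq_pexp2l ?(ltnW p_gt1) //.
set t := trunc_log p m.*2.
have binE : logn p 'C(m.*2, m) + (logn p m`!).*2 = logn p (m.*2)`!.
  have lemm : m <= m.*2 by lia.
  rewrite -(bin_fact lemm) (_ : m.*2 - m = m); last lia.
  by rewrite !lognM ?muln_gt0 ?fact_gt0 ?bin_gt0 // addnn.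
rewrite !logn_fact // in binE.
have t2m : t <= m.*2.
  by apply/ltnW/(leq_trans (ltn_expl t p_gt1)); exact: trunc_logP.
have ext : \sum_(1 <= k < m.+1) m %/ p ^ k = \sum_(1 <= k < m.*2.+1) m %/ p ^ k.
  rewrite [RHS](big_cat_nat (n := m.+1)) //=; last lia.
  rewrite [X in _ = _ + X]big_nat_cond [X in _ = _ + X]big1 ?addn0 // => k /andP[/andP[mk _] _].
  by apply: divn_small; apply: leq_trans mk (ltnW (ltn_expl k p_gt1)).
rewrite ext in binE.
have le_t : \sum_(1 <= k < m.*2.+1) (p ^ k <= m.*2) <= t.
  rewrite (big_cat_nat (n := t.+1)) //=.
  rewrite [X in _ + X]big_nat_cond [X in _ + X]big1 ?addn0 => [|k /andP[/andP[tk _] _]].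
    have tE : \sum_(1 <= k < t.+1) 1 = t by rewrite sum_nat_const_nat subn1 muln1.
    by rewrite -[leqRHS]tE; apply: leq_sum => k _; exact: leq_b1.
  apply/eqP; rewrite eqb0 -ltnNge; apply: leq_trans (trunc_log_ltn m.*2 p_gt1) _.
  by rewrite leq_pexp2l // ltnW.
rewrite -(leq_add2r (\sum_(1 <= k < m.*2.+1) m %/ p ^ k).*2) binE.
apply: leq_trans (leq_add le_t (leqnn _)).
rewrite -[X in _ <= _ + X]mul2n big_distrr -big_split /=; apply: leq_sum => k _.
set q := p ^ k; have q_gt0 : 0 < q by rewrite expn_gt0 ltnW.
have [qm|mq] := leqP q m.*2; last by rewrite divn_small.
rewrite -ltnS ltn_divLR //; have := ltn_ceil m q_gt0.
by rewrite -mul2n; nia.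
Qed.

Lemma bin_ge_exp2 m : 2 ^ m <= 'C(m.*2, m).
Proof.
elim: m => // m IHm; rewrite doubleS expnS binS.
apply: (@leq_trans (2 * 'C(m.*2, m))); first by rewrite leq_mul2l.
have -> : 'C(m.*2.+1, m.+1) = 'C(m.*2.+1, m).
  by rewrite -[RHS]bin_sub; [congr 'C(_, _); lia | lia].
by rewrite addnn -[leqRHS]mul2n leq_mul2l leq_bin2l.
Qed.

(** Chebyshev's argument: the central binomial coefficient has only prime factors
    up to [m.*2], of which there are at most [j], and each of them contributes a
    prime power that is at most [m.*2]. *)
Lemma exp2_le_exp_nth_prime m j : 0 < m -> m.*2 < nth_prime j -> 2 ^ m <= m.*2 ^ j.
Proof.
move=> m_gt0 mj; apply: leq_trans (bin_ge_exp2 m) _.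
have C_gt0 : 0 < 'C(m.*2, m) by rewrite bin_gt0; lia.
rewrite {1}(prod_prime_decomp C_gt0) prime_decompE big_map /=.
apply: (@leq_trans (\prod_(p <- primes 'C(m.*2, m)) m.*2)).
  rewrite big_seq_cond [leqRHS]big_seq_cond; apply: leq_prod => p.
  by rewrite andbT mem_primes => /andP[p_pr _]; exact: pfactor_bin_le.
rewrite big_const_seq count_predT iter_muln_1 leq_pexp2l ?double_gt0 //.
rewrite -(size_iota 0 j) -[leqRHS](size_map nth_prime); apply: uniq_leq_size (primes_uniq _) _.
move=> p; rewrite mem_primes => /and3P[p_pr _ pC].
have p_le : p <= m.*2.
  apply: leq_trans (pfactor_bin_le p_pr m_gt0).
  have lp : 0 < logn p 'C(m.*2, m) by rewrite logn_gt0 mem_primes p_pr C_gt0.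
  by have := leq_pexp2l (prime_gt0 p_pr) lp; rewrite expn1.
have [i ij ->] := prime_lt_nth_prime p_pr (leq_ltn_trans p_le mj).
by apply: map_f; rewrite mem_iota.
Qed.

(** * Small divisors of the odd part of a primorial *)

Definition odd_primorial (m : nat) : nat := \prod_(i < m) nth_prime i.+1.

Lemma primorialS m : primorial m.+1 = (odd_primorial m).*2.
Proof. by rewrite /primorial big_ord_recl mul2n. Qed.

Lemma odd_primorialS m : odd_primorial m.+1 = odd_primorial m * nth_prime m.+1.
Proof. by rewrite /odd_primorial big_ord_recr. Qed.

Lemma nth_prime_odd i : odd (nth_prime i.+1).
Proof.
have [//|even_p] := boolP (odd _).
by have /(@nth_prime_inj i.+1 0) := prime_oddPn (prime_nth_prime i.+1) even_p.
Qed.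

Definition subprod m (S : {set 'I_m}) : nat := \prod_(i in S) nth_prime i.+1.

Lemma odd_primorial_odd m : odd (odd_primorial m).
Proof.
rewrite /odd_primorial; elim/big_ind: _ => // [a b|i _].
  by rewrite oddM => ->.
by rewrite nth_prime_odd.
Qed.

Lemma subprod_gt0 m (S : {set 'I_m}) : 0 < subprod S.
Proof. by apply: prodn_cond_gt0 => i _; rewrite prime_gt0 ?prime_nth_prime. Qed.

Lemma subprodC m (S : {set 'I_m}) : subprod S * subprod (~: S) = odd_primorial m.
Proof.
rewrite /odd_primorial (bigID (mem S)) /=; congr (_ * _).
by apply: eq_bigl => i; rewrite inE.
Qed.

Lemma subprod_dvd m (S : {set 'I_m}) : subprod S %| odd_primorial m.
Proof. by rewrite -(subprodC S) dvdn_mulr. Qed.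

Lemma dvdn_subprod m (S : {set 'I_m}) (i : 'I_m) : (nth_prime i.+1 %| subprod S) = (i \in S).
Proof.
apply/idP/idP => [|iS]; last by rewrite /subprod (bigD1 i) //= dvdn_mulr.
rewrite Euclid_dvd_prod ?prime_nth_prime // big_orE => /existsP[j /andP[jS]].
rewrite dvdn_prime2 ?prime_nth_prime // => /eqP/nth_prime_inj [] ij.
by rewrite (val_inj ij).
Qed.

Lemma subprod_inj m : injective (@subprod m).
Proof. by move=> S T ST; apply/setP => i; rewrite -!dvdn_subprod ST. Qed.

(** Subsets of the set of odd prime factors stand for divisors of the odd
    primorial; the empty one stands for [1], which is excluded because cycles of
    length [2] serve as filler. *)
Definition small_divisor m :=
  {S : {set 'I_m} | (S != finset.set0) && (subprod S ^ 2 <= odd_primorial m)}.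

Lemma card_subsets_ord m : #|{: {set 'I_m}}| = 2 ^ m.
Proof. by rewrite -cardsT -powersetT card_powerset cardsT card_ord. Qed.

(** Of two complementary divisors at least one is small. *)
Lemma card_small_divisor m : 2 ^ m <= #|{: small_divisor m}|.+1.*2.
Proof.
set N := odd_primorial m; pose A : {set {set 'I_m}} := [set S | subprod S ^ 2 <= N]%SET.
have A_small : #|A| <= #|{: small_divisor m}|.+1.
  rewrite card_sig (cardsD1 finset.set0) -add1n leq_add ?leq_b1 //.
  by apply: subset_leq_card; apply/fintype.subsetP => S; rewrite !inE.
have AC : #|~: A| <= #|A|.
  rewrite -(card_imset _ (can_inj (@finset.setCK 'I_m))).
  apply: subset_leq_card; apply/fintype.subsetP => _ /imsetP[S SA ->].
  rewrite !inE -ltnNge in SA *; rewrite leqNgt; apply/negP => CN.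
  have := ltn_mul SA CN; rewrite -expnMn subprodC -/N.
  by rewrite -mulnn ltnn.
rewrite -card_subsets_ord -(cardsC A) -addnn.
exact: leq_add A_small (leq_trans AC A_small).
Qed.

Lemma sum_small_le (I : finType) (e : I -> nat) N : (forall i, e i ^ 2 <= N) ->
  (\sum_i e i) ^ 2 <= #|I| ^ 2 * N.
Proof.
move=> eN; have [I0|I_gt0] := posnP #|I|.
  by rewrite big1 // => i _; have := fintype0 i I0.
have [i0 maxE] := eq_bigmax e I_gt0.
apply: (@leq_trans ((#|I| * e i0) ^ 2)); last by rewrite expnMn leq_mul2l eN orbT.
rewrite leq_sqr -sum_nat_const; apply: leq_sum => i _.
by rewrite -maxE leq_bigmax.
Qed.

(** All prime factors but the first few exceed [16 = 2 * 8]; the spare factor [2]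
    pays for the constant and for these few. *)
Lemma odd_primorial_ge m : 61 <= m -> 24 * 8 ^ m <= odd_primorial m.
Proof.
move=> m_ge.
(* [nth_prime i.+1 >= 16] for [i >= 14]; an abstract [c] keeps [16 ^ c] from
   being computed in unary. *)
have [c cE] : exists c, c = 14 by exists 14.
have le16 : 16 ^ m <= odd_primorial m * 16 ^ c.
  elim: m {m_ge} => [|m IHm].
    by rewrite /odd_primorial big_ord0 mul1n expn_gt0.
  rewrite odd_primorialS.
  have [mc|cm] := leqP m.+1 c.
    apply: leq_trans (leq_pexp2l (isT : 0 < 16) mc) _.
    rewrite leq_pmull // -odd_primorialS odd_gt0 //; exact: odd_primorial_odd.
  rewrite expnSr mulnAC leq_mul //.
  by apply: leq_trans (nth_prime_gt m.+1); lia.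
rewrite -(leq_pmul2r (m := 16 ^ c)) ?expn_gt0 //; apply: leq_trans le16.
rewrite (expnMn 8 2 m : 16 ^ m = _) mulnAC [leqRHS]mulnC leq_mul //.
have -> : 16 ^ c = 2 ^ (4 * c) by rewrite expnM.
apply: (@leq_trans (2 ^ 5 * 2 ^ (4 * c))); first by rewrite leq_mul2r orbT.
by rewrite -expnD leq_pexp2l // cE; lia.
Qed.

(** With [c] small divisors, whose sum is at most [c * sqrt N], the choice of [B]
    gives [B.+1 > M / (c * sqrt N)].  Since [N >= 24 * 8 ^ (k - 1)], this implies
    [B.+1 ^ 8 >= 2 * N]; and [c >= 2 ^ (k - 2) - 1 >= 8 * 2 ^ (k - 6)]. *)
Lemma count_irreducible_primorial k : 62 <= k ->
  exists2 K, count_up_to_iso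
    (fun X : digraph => irreducible_soc X /\
       digraph_iso (dprod (dcycle (primorial k)) X)
                   (dcopies (primorial k) (dcycle (primorial k)))) K
  & primorial k ^ (2 ^ (k - 6)) <= K.
Proof.
case: k => // m m_ge; rewrite primorialS; set N := odd_primorial m.
have N_ge : 24 * 8 ^ m <= N by apply: odd_primorial_ge.
have [M NM] : exists M, N = M.*2.+1.
  by exists N./2; have := odd_double_half N; rewrite odd_primorial_odd.
pose e (S : small_divisor m) := subprod (val S).
have e2 S : e S ^ 2 <= N by have /andP[] := valP S.
pose B := M %/ \sum_S e S.
have [||||S||K PK leK] := @count_irreducible_ge N M (small_divisor m) e _ _ _ _ _ B.
- lia.
- exact: NM.
- by move=> S T /subprod_inj; exact: val_inj.
- move=> S; have /andP[S0 _] := valP S; rewrite ltn_neqAle subprod_gt0 andbT.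
  apply: contraNneq S0 => e1; apply/eqP/subprod_inj.
  by rewrite -/(e S) -e1 /subprod big_set0.
- exact: subprod_dvd.
- by rewrite mulnC leq_trunc_div.
exists K => //; apply: leq_trans leK.
have cardI := card_small_divisor m; have := sum_small_le e2.
set c := #|_| in cardI *; set s := \sum_S e S => s2.
have c_le : c <= 2 ^ m.
  by rewrite /c card_sig -(card_subsets_ord m) max_card.
have B8 : N.*2 <= B.+1 ^ 8.
  have MB : M < B.+1 * s.
    apply: ltn_ceil; rewrite lt0n; apply/eqP => s0.
    have c0 : c = 0.
      apply/eqP; rewrite -leqn0 -s0 /c -sum1_card; apply: leq_sum => S _.
      exact: subprod_gt0.
    have : 2 ^ 2 <= 2 ^ m by rewrite leq_pexp2l //; lia.
    by rewrite leqNgt => /negP[]; move: cardI; rewrite c0 => /leq_ltn_trans; apply.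
  set b := B.+1 in MB *; set u := 2 ^ m in c_le.
  have u_gt0 : 0 < u by rewrite expn_gt0.
  have N_u : 24 * u ^ 3 <= N by rewrite /u -expnM [(m * 3)%N]mulnC expnM.
  have N_lt : N < 9 * (b ^ 2 * u ^ 2).
    have cu : c ^ 2 <= u ^ 2 by rewrite leq_sqr.
    have s2u : s ^ 2 <= u ^ 2 * N by apply: leq_trans s2 _; rewrite leq_mul2r cu orbT.
    have M2 : M ^ 2 < b ^ 2 * (u ^ 2 * N).
      apply: (@leq_trans ((b * s) ^ 2)); first by rewrite ltn_sqr.
      by rewrite expnMn leq_mul2l s2u orbT.
    have N3M : N ^ 2 <= 9 * M ^ 2 by rewrite -[9]/(3 ^ 2) -expnMn leq_sqr; lia.
    have N_gt0 : 0 < N by rewrite NM.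
    rewrite -(ltn_pmul2r N_gt0) mulnn; apply: leq_ltn_trans N3M _.
    by rewrite -(mulnA 9) -(mulnA (b ^ 2)) ltn_pmul2l.
  have {N_lt} : N ^ 4 <= 9 ^ 4 * (b ^ 8 * u ^ 8).
    have -> : 9 ^ 4 * (b ^ 8 * u ^ 8) = (9 * (b ^ 2 * u ^ 2)) ^ 4.
      by rewrite (expnMn 9) (expnMn (b ^ 2)) -(expnM b) -(expnM u).
    by rewrite leq_exp2r // ltnW.
  have N3 : 24 ^ 3 * u ^ 8 <= N ^ 3.
    apply: (@leq_trans ((24 * u ^ 3) ^ 3)); last by rewrite leq_exp2r.
    by rewrite expnMn -expnM leq_mul // leq_pexp2l.
  (* Only this comparison of the two constants is used; they stay powers so that
     they are not expanded in unary. *)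
  have pq : 2 * 9 ^ 4 <= 24 ^ 3 by lia.
  have p_gt0 : 0 < 9 ^ 4 by rewrite expn_gt0.
  move: pq p_gt0 N3; set p := 9 ^ 4; set q := 24 ^ 3; set w := u ^ 8; set x := b ^ 8.
  clearbody p q; move=> pq p_gt0 N3.
  rewrite expnS => /(leq_trans (leq_mul (leqnn N) N3)) N4.
  have w_gt0 : 0 < w by rewrite expn_gt0 u_gt0.
  clearbody w x; clear N3.
  rewrite -(leq_pmul2r w_gt0) -(leq_pmul2l p_gt0); apply: leq_trans N4.
  have -> : p * (N.*2 * w) = N * w * (2 * p) by lia.
  have -> : N * (q * w) = N * w * q by lia.
  by rewrite leq_mul2l pq orbT.
have [m' mE] : exists m', m = m' + 5 by exists (m - 5); lia.
have -> : m.+1 - 6 = m' by lia.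
have c_ge : 8 * 2 ^ m' <= c.
  have t_gt0 : 0 < 2 ^ m' by rewrite expn_gt0.
  by move: cardI; rewrite mE expnD; set t := 2 ^ m' in t_gt0 *; lia.
apply: leq_trans (leq_pexp2l (ltn0Sn B) c_ge).
by rewrite expnM leq_exp2r ?expn_gt0.
Qed.

(** * Logarithms of primorials *)

Import Order.TTheory GRing.Theory Num.Theory.
Local Open Scope ring_scope.

Section Analytic.
Variable R : realType.
Implicit Types (delta : R) (j k : nat).

Lemma ln2_ge : 1 / 2 <= ln 2 :> R.
Proof.
have : ln (1 + (- (1 / 2))) <= - (1 / 2) :> R by apply: le_ln1Dx; lra.
have -> : 1 + - (1 / 2) = 2^-1 :> R by lra.
by rewrite lnV ?posrE //; lra.
Qed.

(** With [y = q - 1], where [q] is the prime at hand, [exp2_le_exp_nth_prime]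
    gives [y <= 4 j ln y].  Taking logarithms, [ln (ln y)] is absorbed by
    [ln (ln y) <= delta ln y - ln delta]. *)
Lemma ln_nth_prime_le delta j : 0 < delta < 1 -> (0 < j)%N ->
  (1 - delta) * ln (nth_prime j)%:R <= ln j%:R + 3 * ln 2 - ln delta.
Proof.
move=> /andP[d_gt0 d_lt1] j_gt0; set q := nth_prime j.
have q_odd : odd q by case: j j_gt0 @q => // i _; exact: nth_prime_odd.
have q_gt2 : (2 < q)%N by rewrite -[2%N]/(nth_prime 0) ltnNge leq_nth_prime -ltnNge.
pose m := q./2; have qE : q = m.*2.+1 by have := odd_double_half q; rewrite q_odd.
have m_gt0 : (0 < m)%N by lia.
have /(exp2_le_exp_nth_prime m_gt0) exp_le : (m.*2 < q)%N by rewrite qE.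
clearbody q m.
pose y : R := m.*2%:R; have y_ge2 : 2 <= y by rewrite (ler_nat R 2); lia.
pose L := ln y; have L_gt0 : 0 < L by apply: ln_gt0; lra.
have jR_gt0 : 0 < j%:R :> R by rewrite ltr0n.
have ln2 := ln2_ge.
have y_le : y <= 4 * (j%:R * L).
  have : ln ((2 ^ m)%:R : R) <= ln ((m.*2 ^ j)%:R : R).
    by rewrite ler_ln ?posrE ?ltr0n ?expn_gt0 ?ler_nat //; lia.
  rewrite !natrX !lnXn ?ltr0n //; last lia.
  rewrite -(mulr_natl (ln 2)) -(mulr_natl (ln _)) -/y -/L => le_jL.
  have yE : y = m%:R * 2 by rewrite /y -muln2 natrM.
  have : m%:R * (1 / 2) <= m%:R * ln 2 :> R by rewrite ler_wpM2l.
  lra.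
have ln4 : ln (4 : R) = 2 * ln 2.
  have -> : 4 = 2 ^+ 2 :> R by rewrite -natrX.
  by rewrite lnXn ?ltr0n // mulr_natl.
have L_le : L <= 2 * ln 2 + ln j%:R + ln L.
  rewrite -ln4 -addrA -lnM ?posrE // -lnM ?posrE ?mulr_gt0 //.
  by rewrite ler_ln ?posrE ?mulr_gt0 //; lra.
have lnL_le : ln L <= delta * L - ln delta.
  have : ln (delta * L) < delta * L by apply: ln_sublinear; exact: mulr_gt0.
  by rewrite lnM ?posrE //; lra.
have lnq_le : ln (q%:R : R) <= ln 2 + L.
  rewrite -lnM ?posrE; [|lra..].
  rewrite ler_ln ?posrE ?mulr_gt0 ?ltr0n //; [|exact: ltn_trans q_gt2|by rewrite double_gt0].
  by rewrite qE -addn1 natrD -/y; lra.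
have : (1 - delta) * ln q%:R <= (1 - delta) * (ln 2 + L) by rewrite ler_wpM2l //; lra.
have : 0 <= delta * ln 2 by rewrite mulr_ge0 //; lra.
lra.
Qed.

Lemma primorial_le j : (primorial j.+1 <= nth_prime j ^ j.+1)%N.
Proof.
apply: leq_trans (leq_prod (E2 := fun=> nth_prime j) _) _ => [i _|].
  by rewrite leq_nth_prime -ltnS.
by rewrite prod_nat_const card_ord.
Qed.

Lemma primorial_ge k : (2 ^ k <= primorial k)%N.
Proof.
rewrite -[k in leqLHS]card_ord -prod_nat_const.
by apply: leq_prod => i _; rewrite prime_gt1 ?prime_nth_prime.
Qed.

Lemma ln_primorial_ge k : k%:R / 2 <= ln (primorial k)%:R :> R.
Proof.
have : ln ((2 ^ k)%:R : R) <= ln (primorial k)%:R.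
  rewrite ler_ln ?posrE ?ltr0n ?ler_nat ?primorial_ge ?expn_gt0 //.
  by apply: leq_trans (primorial_ge k); rewrite expn_gt0.
rewrite natrX lnXn ?ltr0n // -(mulr_natl (ln 2)).
have : k%:R * (1 / 2) <= k%:R * ln 2 :> R by rewrite ler_wpM2l // ln2_ge.
lra.
Qed.

Lemma primorial_lt j k : (j < k)%N -> (primorial j < primorial k)%N.
Proof.
apply: (homo_ltn ltn_trans) => i; rewrite /primorial big_ord_recr /= -/(primorial i).
rewrite ltn_Pmulr ?prime_gt1 ?prime_nth_prime //.
by apply: leq_trans (primorial_ge i); rewrite expn_gt0.
Qed.

(** Three losses of a factor [1 + O(d)] must fit into [1 + eps]: replacing [k] by
    [k - 6], the additive constants beside [ln k], and the factor [1 / (1 - d)]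
    in [ln_nth_prime_le]. *)
Lemma ln_primorial_le eps : 0 < eps -> exists k0, forall k, (k0 <= k)%N ->
  ln (primorial k)%:R <= (k - 6)%:R * ((1 + eps) * ln (ln (primorial k)%:R)) :> R.
Proof.
move=> eps_gt0.
(* This choice makes [(1 + d) ^ 2 / (1 - d) <= 1 + eps]. *)
pose d := Num.min (eps / 8) (1 / 8).
have d_gt0 : 0 < d by rewrite /d lt_min; apply/andP; split; lra.
have d_le : d <= 1 / 8 by rewrite /d ge_min lexx orbT.
have d_eps : 8 * d <= eps by have : d <= eps / 8 by [rewrite /d ge_min lexx]; lra.
pose A := 3 * ln 2 - ln d + (1 + d) * ln 2.
pose D := Num.max (expR (A / d)) (6 * (1 + d) / d).
exists (Num.truncn D).+2 => k k_ge.
have D_le : D <= k%:R.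
  by apply: le_trans (ltW (truncnS_gt D)) _; rewrite ler_nat ltnW.
move: D_le; rewrite ge_max => /andP[kA k6].
case: k k_ge k6 kA => // j k_ge k6 kA; set k := j.+1 in k_ge k6 kA *.
have j_gt0 : (0 < j)%N by lia.
have k_gt0 : 0 < k%:R :> R by rewrite ltr0n.
set n := primorial k; set q := nth_prime j.
have lk_ge : A <= d * ln k%:R.
  rewrite -ler_pdivrMl // mulrC -[leLHS]expRK ler_ln ?posrE ?expR_gt0 //.
have k_le : k%:R <= (1 + d) * (k - 6)%:R.
  have k_ge6 : (6 <= k)%N.
    rewrite -(ler_nat R); apply: le_trans k6; rewrite ler_pdivlMr //; lra.
  rewrite natrB //; move: k6; rewrite ler_pdivrMr //; lra.
have ln2 := ln2_ge.
have ln_n : ln n%:R <= k%:R * ln q%:R :> R.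
  have n_gt0 : (0 < n)%N by rewrite (leq_trans _ (primorial_ge k)) ?expn_gt0.
  have n_le : (n <= q ^ k)%N := primorial_le j.
  have : ln n%:R <= ln ((q ^ k)%:R : R).
    by rewrite ler_ln ?posrE ?ltr0n ?ler_nat // (leq_trans n_gt0).
  by rewrite natrX lnXn ?ltr0n ?prime_gt0 ?prime_nth_prime // mulr_natl.
have ln_n_ge := ln_primorial_ge k.
have lnln_ge : ln k%:R - ln 2 <= ln (ln n%:R) :> R.
  rewrite -ln_div ?posrE // ler_ln ?posrE //; [lra|].
  by apply: lt_le_trans ln_n_ge; lra.
have lnq : (1 - d) * ln q%:R <= (1 + d) * (ln k%:R - ln 2).
  have := @ln_nth_prime_le d j; rewrite d_gt0 j_gt0 -/q => /(_ _ isT) lnq.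
  have {}lnq := lnq ltac:(lra).
  have : ln j%:R <= ln k%:R :> R by rewrite ler_ln ?posrE ?ltr0n // ler_nat /k.
  move: lk_ge; rewrite /A; lra.
set X := ln k%:R - ln 2 in lnln_ge lnq.
have q_gt1 : 1 < q%:R :> R by rewrite ltr1n prime_gt1 // prime_nth_prime.
have lnq_ge0 : 0 < ln q%:R :> R by apply: ln_gt0.
have X_gt0 : 0 < X.
  have : 0 < (1 - d) * ln q%:R by rewrite mulr_gt0 //; lra.
  by move=> /lt_le_trans/(_ lnq); rewrite pmulr_rgt0 //; lra.
apply: le_trans ln_n _; set Y := ln (ln n%:R) in lnln_ge *; set Q := ln _ in lnq lnq_ge0 *.
set K : R := (k - 6)%:R in k_le *.
have K_ge0 : 0 <= K by exact: ler0n.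
have step1 : k%:R * Q <= (1 + d) * K * Q by rewrite ler_wpM2r // ltW.
apply: le_trans step1 _.
have : (1 - d) * ((1 + d) * Q) <= (1 - d) * ((1 + eps) * Y).
  have : (1 + d) * ((1 - d) * Q) <= (1 + d) * ((1 + d) * X) by rewrite ler_wpM2l //; lra.
  have : (1 - d) * (1 + eps) * X <= (1 - d) * (1 + eps) * Y.
    by rewrite ler_wpM2l // mulr_ge0; lra.
  have : (1 + d) * (1 + d) * X <= (1 - d) * (1 + eps) * X.
    rewrite ler_wpM2r ?ltW //.
    have : 0 <= (1 - d) * (eps - 8 * d) by rewrite mulr_ge0; lra.
    nra.
  lra.
rewrite ler_pM2l; last lra.
move=> /(ler_wpM2l K_ge0); lra.
Qed.
End Analytic.

Theorem theorem2 (R : realType) (eps : R) (eps_gt0 : 0 < eps) :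
  exists n0 : nat, forall n : nat, is_primorial n -> (n0 <= n)%N ->
    exists N : nat,
      count_up_to_iso
        (fun X : digraph =>
           irreducible_soc X /\
           digraph_iso (dprod (dcycle n) X) (dcopies n (dcycle n))) N /\
      n%:R `^ (2 `^ (ln n%:R / ((1 + eps) * ln (ln n%:R)))) <= N%:R :> R.
Proof.
have [k0 k0P] := ln_primorial_le eps_gt0.
exists (primorial (maxn k0 62)) => n [k _ ->{n}] n0_le.
have : (maxn k0 62 <= k)%N by rewrite leqNgt; apply/negP => /primorial_lt; rewrite ltnNge n0_le.
rewrite geq_max => /andP[k0_le k_ge].
have [K PK leK] := count_irreducible_primorial k_ge.
exists K; split=> //; set n := primorial k in PK leK *.
have lnn_gt1 : 1 < ln n%:R :> R.
  apply: lt_le_trans (ln_primorial_ge R k).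
  have : 62 <= k%:R :> R by rewrite (ler_nat R 62).
  lra.
have n_gt1 : 1 < n%:R :> R.
  have : 0 < n%:R :> R by rewrite ltr0n (leq_trans _ (primorial_ge k)) ?expn_gt0.
  by move=> /ln_sublinear; apply: lt_trans.
apply: le_trans (_ : (n ^ (2 ^ (k - 6)))%:R <= _); last by rewrite ler_nat.
rewrite natrX -powR_mulrn ?ler0n //; apply: ler_powR; first lra.
rewrite natrX -powR_mulrn //; apply: ler_powR; first lra.
rewrite ler_pdivrMr; last by rewrite mulr_gt0 ?ln_gt0 //; lra.
exact: k0P.
Qed.
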